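(* Let $p\ge q\ge 1$ be integers. Let $P^{\mathrm{comp}}_{p,q}\subseteq\mathbb{R}^{\mathcal{I}_{p,q}}\times\mathbb{R}^{\mathcal{I}_{p,q}}$ be the polytope of all $(z,w)$ satisfying $$\begin{aligned} w_{i+1,j+1}-w_{i,j+1}&\ge 0 &&\text{for } i\in[p-1]_0,\ j\in[q(i+1)-1]_0,\\ w_{i,j}-w_{i+1,j+1}&\ge 0 &&\text{for } (i,j)\in\mathcal{I}_{p,q},\ i<p,\\ w_{p,1}&\le 1,\\ w_{i,j}-w_{i-1,j}-z_{i,j}+z_{i,j+1}&\le 0 &&\text{for } (i,j)\in\mathcal{I}_{p,q},\\ z_{i,j}-w_{i,j}&\le 0 &&\text{for } (i,j)\in\mathcal{I}_{p,q},\\ w_{i,q(i)}&\ge 0 &&\text{for } i\in[p], \end{aligned}$$ where $z_{i,j}$ and $w_{i,j}$ are read as $0$ whenever $j>q(i)$. Then $P^{\mathrm{comp}}_{p,q}$ is an extended formulation of the packing orbitope $O^{\le}_{p,q}$. Moreover, the face of $P^{\mathrm{comp}}_{p,q}$ defined by $w_{1,1}=1$ is an extended formulation of the partitioning orbitope $O^{=}_{p,q}$.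
   Context: Notation: $[n]=\{1,\dots,n\}$, $[n]_0=\{0,1,\dots,n\}$, $q(i)=\min\{i,q\}$ (so $q(0)=0$), $\mathcal{I}_{p,q}=\{(i,j)\in[p]\times[q] : i\ge j\}$. The packing orbitope $O^{\le}_{p,q}$ (resp. the partitioning orbitope $O^{=}_{p,q}$) is the convex hull of all 0/1-matrices of size $p\times q$ whose columns are in lexicographically decreasing (i.e., non-increasing, with row 1 the most significant position) order and that have at most one (resp. exactly one) 1-entry per row. Since no such matrix has a 1 above its main diagonal, the entries $(i,j)$ with $i<j$ are dropped and $O^{=}_{p,q}\subseteq O^{\le}_{p,q}$ are regarded as subsets of $\mathbb{R}^{\mathcal{I}_{p,q}}$. An extended formulation of a polytope $Q$ is a linear description of a polytope $P$ in a higher-dimensional space (by abuse of language, also $P$ itself) such that $Q$ is a linear projection of $P$, i.e., the image of $P$ under some linear map. *)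

(* Defs.v *)
From HB Require Import structures.
From mathcomp Require Import all_boot all_order all_algebra.
From mathcomp Require Import all_classical reals.

Set Implicit Arguments.
Unset Strict Implicit.
Unset Printing Implicit Defensive.

Import Order.TTheory GRing.Theory Num.Theory.
Local Open Scope classical_set_scope.
Local Open Scope ring_scope.

Definition conv_hull (R : realType) (V : lmodType R) (A : set V) : set V :=
  [set x | exists (n : nat) (a : 'I_n -> R) (v : 'I_n -> V),
     [/\ forall k, 0 <= a k, \sum_k a k = 1, forall k, A (v k)
       & x = \sum_k a k *: v k]].

Definition polyhedron (R : realType) (V : lmodType R) (P : set V) : Prop :=
  exists (K : finType) (a : K -> {linear V -> R^o}) (b : K -> R),
    P = [set x | forall k, a k x <= b k].

(* Boundedness does not depend on the basis used to read off coordinates. *)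
Definition bounded_in (R : realType) (V : vectType R) (P : set V) : Prop :=
  exists M : R, forall x, P x ->
    forall k, `|coord (vbasis {:V}%VS) k x| <= M.

Definition polytope (R : realType) (V : vectType R) (P : set V) : Prop :=
  polyhedron P /\ bounded_in P.

Definition extended_formulation (R : realType) (U V : vectType R)
    (P : set U) (Q : set V) : Prop :=
  [/\ polytope P, (\dim {:V} < \dim {:U})%N
    & exists f : {linear U -> V}, f @` P = Q].

(* The index set I_{p,q}. Ordinals count from 0, so the element (i, j) of
   [tri p q] stands for the pair (i + 1, j + 1). *)
Definition tri (p q : nat) := {ij : 'I_p * 'I_q | (ij.2 <= ij.1)%N}.

Definition trivec (R : realType) (p q : nat) := {ffun tri p q -> R^o}.

(* x_{i,j} with 1-based i and j; it is 0 when (i, j) is not in I_{p,q}, in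
   particular whenever j > min(i, q). *)
Definition ent (R : realType) (p q : nat) (x : trivec R p q) (i j : nat) : R :=
  if [pick k : tri p q | ((val k).1.+1 == i) && ((val k).2.+1 == j)] is Some k
  then x k else 0.

Definition in_tri (p q i j : nat) : bool :=
  [&& (1 <= i <= p)%N, (1 <= j <= q)%N & (j <= i)%N].

Section Orbitopes.
Variables (R : realType) (p q : nat).

Definition zero_one (A : 'M[R]_(p, q)) : Prop :=
  forall i j, A i j = 0 \/ A i j = 1.

Definition lex_columns (A : 'M[R]_(p, q)) : Prop :=
  forall j k : 'I_q, (j < k)%N ->
    ([tuple A i k | i < p] <= [tuple A i j | i < p] :> p.-tuplelexi R)%O.

Definition drop_upper (A : 'M[R]_(p, q)) : trivec R p q :=
  [ffun k => A (val k).1 (val k).2].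

Definition packing_orbitope : set (trivec R p q) :=
  drop_upper @` conv_hull [set A : 'M[R]_(p, q) |
    [/\ zero_one A, lex_columns A
      & forall i, (#|[set j | A i j == 1%R]%SET| <= 1)%N]].

Definition partitioning_orbitope : set (trivec R p q) :=
  drop_upper @` conv_hull [set A : 'M[R]_(p, q) |
    [/\ zero_one A, lex_columns A
      & forall i, #|[set j | A i j == 1%R]%SET| = 1%N]].

Definition Pcomp : set (trivec R p q * trivec R p q) :=
  [set zw | let z := ent zw.1 in let w := ent zw.2 in
    (forall i j, (i < p)%N -> (j < minn i.+1 q)%N ->
       0 <= w i.+1 j.+1 - w i j.+1) /\
    (forall i j, in_tri p q i j -> (i < p)%N ->
       0 <= w i j - w i.+1 j.+1) /\
    w p 1%N <= 1 /\
    (forall i j, in_tri p q i j ->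
       w i j - w i.-1 j - z i j + z i j.+1 <= 0) /\
    (forall i j, in_tri p q i j -> z i j - w i j <= 0) /\
    (forall i, (1 <= i <= p)%N -> 0 <= w i (minn i q))].

Definition Pcomp_face : set (trivec R p q * trivec R p q) :=
  Pcomp `&` [set zw | ent zw.2 1%N 1%N = 1].

End Orbitopes.

(* Main.v *)
(* The 0/1 points of the compact system are exactly the pairs in which
   [w i j = 1] iff column [j] of a packing matrix has a 1-entry in the first [i]
   rows, and [z i j = 1] iff its row [i] has a 1-entry in column [j] or later;
   lexicographic order of the columns means that the first 1-entry of a column
   lies strictly below that of the preceding column. Such a point is sent to its
   matrix by x_{i,j} = z_{i,j} - z_{i,j+1}.

   Integrality: replacing [w] by the indicator of its support, and rounding [z]
   to match, turns any point [y] of the polytope into a 0/1 point at which all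
   constraints tight at [y] stay tight. Pushing [y] away from that point until a
   new constraint becomes tight, and repeating, writes [y] as a convex
   combination of 0/1 points.

   On the face w_{1,1} = 1 the same projection does not work, because z_{i,1}
   may still vanish for i > 1. There x_{i,1} = w_{i,1} - z_{i,2} is used
   instead. *)
Require Import Defs.
From HB Require Import structures.
From mathcomp Require Import all_boot all_order all_algebra.
From mathcomp Require Import all_classical reals.
From mathcomp Require Import lra zify ring.

Set Implicit Arguments.
Unset Strict Implicit.
Unset Printing Implicit Defensive.

Import Order.TTheory GRing.Theory Num.Theory.
Local Open Scope classical_set_scope.
Local Open Scope ring_scope.

(** * Convex hulls, and polyhedra generated by rounded points *)

Section ConvexHulls.
Variable R : realType.

Lemma sub_conv_hull (V : lmodType R) (S : set V) : S `<=` conv_hull S.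
Proof.
move=> s Ss; exists 1%N, (fun=> 1), (fun=> s).
by split=> //; rewrite big_ord1 // scale1r.
Qed.

Lemma conv_hull_cons (V : lmodType R) (S : set V) (m : R) (s x : V) :
  0 <= m <= 1 -> S s -> conv_hull S x -> conv_hull S (m *: s + (1 - m) *: x).
Proof.
case/andP=> m0 m1 Ss [n [a [v [a0 a1 Sv ->]]]].
pose cons T (c : T) (d : 'I_n -> T) (k : 'I_n.+1) :=
  if unlift ord0 k is Some l then d l else c.
exists n.+1, (cons _ m (fun k => (1 - m) * a k)), (cons _ s v); split.
- by rewrite /cons => k; case: unliftP => //= l _; rewrite mulr_ge0 ?subr_ge0.
- rewrite big_ord_recl /cons unlift_none.
  under eq_bigr do rewrite liftK.
  by rewrite -mulr_sumr a1 mulr1 addrC subrK.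
- by rewrite /cons => k; case: unliftP.
- rewrite big_ord_recl /cons !unlift_none; congr (_ + _).
  by rewrite scaler_sumr; apply: eq_bigr => k _; rewrite !liftK scalerA.
Qed.

Lemma image_conv_hull (V W : lmodType R) (f : {linear V -> W}) (S : set V) :
  f @` conv_hull S = conv_hull (f @` S).
Proof.
apply/seteqP; split=> [_ [x [n [a [v [a0 a1 Sv ->]]]] <-]|].
  exists n, a, (f \o v); split=> //; first by move=> k; exists (v k).
  by rewrite linear_sum; apply: eq_bigr => k _; rewrite linearZ.
move=> _ [n [a [v [a0 a1 Sv ->]]]].
have /choice[u Su] : forall k, exists x, S x /\ f x = v k.
  by move=> k; have [x] := Sv k; exists x.
exists (\sum_k a k *: u k).
  by exists n, a, u; split=> // k; have [] := Su k.
rewrite linear_sum; apply: eq_bigr => k _.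
by rewrite linearZ /=; have [_ ->] := Su k.
Qed.

Lemma halfspaces_conv_hull (V : lmodType R) (K : Type)
    (a : K -> {linear V -> R^o}) (b : K -> R) (S : set V) :
  (forall s, S s -> forall k, a k s <= b k) ->
  forall x, conv_hull S x -> forall k, a k x <= b k.
Proof.
move=> SP x [n [c [v [c0 c1 Sv ->]]]] k; rewrite linear_sum.
rewrite -[leRHS]mul1r -c1 mulr_suml ler_sum // => l _.
by rewrite linearZ; apply: ler_wpM2l => //; apply: SP.
Qed.

(* Follow the ray that starts at [s] and passes through a point [y] of the
   polyhedron until it leaves the polyhedron: the constraints tight at [y] stay
   tight along it, and the exit point has a further tight constraint. *)
Lemma polyhedron_eq_conv_hull (V : lmodType R) (K : finType)
    (a : K -> {linear V -> R^o}) (b : K -> R) (S : set V) :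
  (forall d, (forall k, a k d <= 0) -> d = 0) ->
  (forall s, S s -> forall k, a k s <= b k) ->
  (forall y, (forall k, a k y <= b k) ->
     exists2 s, S s & forall k, a k y = b k -> a k s = b k) ->
  [set x | forall k, a k x <= b k] = conv_hull S.
Proof.
move=> rec0 SP round; apply/seteqP; split=> [y /=|]; last first.
  exact: halfspaces_conv_hull.
have [n] := ubnP #|[pred k | a k y < b k]|; elim: n y => // n IHn y ltyn Py.
have [s Ss tight] := round y Py.
have [->|ys] := eqVneq y s; first exact: sub_conv_hull.
(* Otherwise [y - s] would lie in the recession cone, which [rec0] makes trivial. *)
have [k0 dk0] : exists k, 0 < a k (y - s).
  apply/not_existsP => d0; move/eqP: ys; apply; apply/eqP.
  rewrite -subr_eq0; apply/eqP/rec0 => k.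
  by rewrite leNgt; apply/negP/d0.
(* Ratio test: [k1] is the first constraint that the ray leaving [s] runs into, and [l] is the
   parameter of the exit point [x]. Since [y] is feasible and has parameter 1, [l >= 1]. *)
case: (@arg_minP _ _ _ k0 (fun k => 0 < a k (y - s))
   (fun k => (b k - a k s) / a k (y - s)) dk0) => k1 dk1 mink1.
set l := (b k1 - a k1 s) / a k1 (y - s) in mink1.
have aB k : a k (y - s) = a k y - a k s by rewrite linearB.
have l1 : 1 <= l by rewrite ler_pdivlMr // mul1r aB; have := Py k1; lra.
have l0 : 0 < l by exact: lt_le_trans l1.
pose x := s + l *: (y - s).
have ax k : a k x = a k s + l * a k (y - s) by rewrite [LHS]linearD linearZ.
have Px k : a k x <= b k.
  rewrite ax -lerBrDl; have [dk|dk] := ltP 0 (a k (y - s)).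
    by rewrite -ler_pdivlMr //; exact: mink1.
  rewrite (@le_trans _ _ 0) ?subr_ge0 ?SP //.
  by rewrite pmulr_rle0.
have tx k : a k y = b k -> a k x = b k.
  by move=> tk; rewrite ax aB tk tight // subrr mulr0 addr0.
have -> : y = (1 - l^-1) *: s + (1 - (1 - l^-1)) *: x.
  rewrite opprB addrCA subrr addr0 scalerDr scalerA mulVf ?gt_eqF // scale1r.
  by rewrite scalerBl scale1r addrA subrK addrC subrK.
apply: conv_hull_cons => //.
  by rewrite subr_ge0 invf_le1 // l1 /= gerBl invr_ge0 ltW.
apply: IHn => //; rewrite -ltnS; apply: leq_trans ltyn; rewrite ltnS.
apply: proper_card; apply/properP; split.
  apply/fintype.subsetP => k; rewrite !inE => tk; rewrite lt_neqAle Py andbT.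
  by apply/eqP => /tx; move: tk => /[swap] ->; rewrite ltxx.
exists k1; rewrite !inE.
  rewrite lt_neqAle Py andbT; apply/eqP => tk1.
  by move: dk1; rewrite aB tk1 tight // subrr ltxx.
by rewrite ax /l divfK ?gt_eqF // addrC subrK ltxx.
Qed.

(** [vbasis] is not explicit, so boundedness is transferred from a convenient family [e]. Summing
    over [k] as well gives one bound for all coordinates. *)
Lemma bounded_in_span (V : vectType R) (L : finType) (e : L -> V) (P : set V) :
  (forall x, P x -> exists2 c : L -> R, forall l, `|c l| <= 1
     & x = \sum_l c l *: e l) ->
  bounded_in P.
Proof.
move=> Pe; exists (\sum_k \sum_l `|coord (vbasis {:V}%VS) k (e l)|).
move=> x /Pe[c c1 ->] k; rewrite linear_sum.
rewrite [leRHS](bigD1 k) //= ler_wpDr ?sumr_ge0 // => [l _|]; first exact: sumr_ge0.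
rewrite (le_trans (ler_norm_sum _ _ _)) // ler_sum // => l _.
by rewrite linearZ normrM ler_piMl.
Qed.

End ConvexHulls.

(** * Triangular vectors read through natural-number indices *)

Section Entries.
Variables (R : realType) (p q : nat).
Implicit Types (x y : trivec R p q) (g : nat -> nat -> R).

Lemma ent_val x (k : tri p q) : ent x (val k).1.+1 (val k).2.+1 = x k.
Proof.
rewrite /ent; case: pickP => [l /andP[/eqP[l1] /eqP[l2]]|/(_ k)]; last by rewrite !eqxx.
congr (x _); apply: val_inj.
by rewrite [LHS]surjective_pairing (val_inj l1) (val_inj l2) -surjective_pairing.
Qed.

Lemma ent_out x i j : ~~ in_tri p q i j -> ent x i j = 0.
Proof.
move=> out; rewrite /ent; case: pickP => // k /andP[/eqP ki /eqP kj].
by move: out; rewrite /in_tri -ki -kj !ltn_ord /= ltnS (valP k).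
Qed.

Lemma in_triP i j : in_tri p q i j ->
  exists k : tri p q, i = (val k).1.+1 /\ j = (val k).2.+1.
Proof.
case: i j => [|i] [|j] //; rewrite /in_tri ?andbF //= => /and3P[ip jq ji].
by exists (exist _ (Ordinal ip, Ordinal jq) ji).
Qed.

Lemma ent_linear c x y i j : ent (c *: x + y) i j = c * ent x i j + ent y i j.
Proof.
have [/in_triP[k [-> ->]]|out] := boolP (in_tri p q i j); last first.
  by rewrite !ent_out // mulr0 addr0.
by rewrite !ent_val !ffunE.
Qed.

Lemma ent0 i j : ent (0 : trivec R p q) i j = 0.
Proof. by rewrite -(subrr 0) -scaleN1r addrC ent_linear mulN1r addNr. Qed.

Lemma trivec_eqP x y : (forall i j, ent x i j = ent y i j) -> x = y.
Proof. by move=> xy; apply/ffunP => k; rewrite -!ent_val xy. Qed.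

Definition of_ent g : trivec R p q :=
  [ffun k : tri p q => g (val k).1.+1 (val k).2.+1].

Lemma ent_of_ent g i j :
  ent (of_ent g) i j = if in_tri p q i j then g i j else 0.
Proof.
case: ifPn => [/in_triP[k [-> ->]]|]; last exact: ent_out.
by rewrite ent_val ffunE.
Qed.

End Entries.

(** * The compact system and the rounding of its points *)

Section CompactSystem.
Variables (R : realType) (p q : nat).

(* Here [z i j] and [w i j] stand for z_{i+1,j+1} and w_{i,j+1}, that is, rows
   and columns count from 0, and row 0 of [w] is the zero row above the first
   one. *)
Definition compact (t : R) (z w : nat -> nat -> R) : Prop :=
  [/\ (forall j, w 0%N j = 0) /\
        (forall i j, (i < p)%N -> (q <= j)%N -> z i j = 0),
      forall i j, (i < p)%N -> w i j <= w i.+1 j /\ w i.+1 j.+1 <= w i j,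
      w p 0%N <= t,
      forall i j, (i < p)%N -> w i.+1 j - w i j <= z i j - z i j.+1
    & forall i j, (i < p)%N -> z i j <= w i.+1 j].

Section Theory.
Variables (t : R) (z w : nat -> nat -> R).
Hypothesis zwP : compact t z w.

Let w0 j : w 0%N j = 0. Proof. by case: zwP => -[]. Qed.
Let zq i j : (i < p)%N -> (q <= j)%N -> z i j = 0.
Proof. by case: zwP => -[_ +] _ _ _ _; apply. Qed.
Let wS i j : (i < p)%N -> w i j <= w i.+1 j.
Proof. by case: zwP => _ /(_ i j) + _ _ _ => /[apply] -[]. Qed.
Let wSS i j : (i < p)%N -> w i.+1 j.+1 <= w i j.
Proof. by case: zwP => _ /(_ i j) + _ _ _ => /[apply] -[]. Qed.
Let cover i j : (i < p)%N -> w i.+1 j - w i j <= z i j - z i j.+1.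
Proof. by case: zwP => _ _ _ + _; apply. Qed.
Let zlew i j : (i < p)%N -> z i j <= w i.+1 j.
Proof. by case: zwP => _ _ _ _; apply. Qed.

Lemma compact_w_homo i i' j : (i <= i' <= p)%N -> w i j <= w i' j.
Proof.
elim: i' => [|i' IHi] /andP[]; first by rewrite leqn0 => /eqP->.
rewrite leq_eqVlt => /predU1P[-> //|ii' i'p].
by apply: le_trans (wS _ i'p); rewrite IHi // -ltnS ii' ltnW.
Qed.

Lemma compact_w_ge0 i j : (i <= p)%N -> 0 <= w i j.
Proof. by move=> ip; rewrite -(w0 j) compact_w_homo. Qed.

Lemma compact_w_anti i j : (i <= p)%N -> w i j.+1 <= w i j.
Proof.
case: i => [|i] ip; first by rewrite !w0.
exact: le_trans (wSS _ ip) (wS _ ip).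
Qed.

Lemma compact_w_le i j : (i <= p)%N -> w i j <= t.
Proof.
move=> ip; have wp0 : w p 0%N <= t by case: zwP.
apply: le_trans wp0; apply: (@le_trans _ _ (w i 0%N)).
  by elim: j => // j; apply: le_trans; exact: compact_w_anti.
by rewrite compact_w_homo // ip leqnn.
Qed.

Lemma compact_z_antiS i j : (i < p)%N -> z i j.+1 <= z i j.
Proof. by move=> ip; have := cover j ip; have := wS j ip; lra. Qed.

Lemma compact_z_anti i j k : (i < p)%N -> (j <= k)%N -> z i k <= z i j.
Proof.
move=> ip; elim: k => [|k IHk]; first by rewrite leqn0 => /eqP->.
rewrite leq_eqVlt => /predU1P[-> //|jk].
exact: le_trans (compact_z_antiS _ ip) (IHk _).
Qed.

Lemma compact_z_ge0 i j : (i < p)%N -> 0 <= z i j.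
Proof.
move=> ip; rewrite -(zq ip (leq_addl j q)).
by apply: compact_z_anti; rewrite ?leq_addr.
Qed.

Lemma compact_z_le i j : (i < p)%N -> z i j <= t.
Proof. by move=> ip; apply: le_trans (zlew _ ip) (compact_w_le _ _). Qed.

(** Above the diagonal, the diagonal inequalities lead back to the zero row. From column [q] on, [z]
    vanishes, so the covering inequality stops [w] from growing from row to row. *)
Lemma compact_w_out i j : (i <= p)%N -> (i <= j)%N || (q <= j)%N -> w i j = 0.
Proof.
elim: i j => [|i IHi] j ip; first by rewrite w0.
move=> out; apply/eqP; rewrite eq_le compact_w_ge0 // andbT.
case/orP: out => [|qj].
  case: j => [|j] ij; first by rewrite ltn0 in ij.
  by rewrite (le_trans (wSS _ ip)) // IHi ?(ltnW ip) // -ltnS ij.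
have := cover j ip; rewrite !zq ?(leqW qj) // IHi ?qj ?orbT ?(ltnW ip) //.
by rewrite !subr0.
Qed.

(* Rounding: [w] is replaced by the indicator of its support. In each row, [z]
   is rounded with its last nonzero difference at the largest [l] at which the
   covering inequality forces a 1 or is not tight. *)
Definition round_w i j : bool := 0 < w i j.

Definition pivot i l : bool :=
  ((0 < w i.+1 l) && (w i l == 0)) || (w i.+1 l - w i l < z i l - z i l.+1).

Definition round_z i j : bool := [exists l : 'I_q, (j <= l)%N && pivot i l].

(** In the slack case, [0 <= w i.+1 l - w i l < z i l - z i l.+1 <= z i l <= w i.+1 l]. *)
Lemma pivot_w_gt0 i l : (i < p)%N -> pivot i l -> 0 < w i.+1 l.
Proof.
move=> ip /orP[/andP[]//|]; have := zlew l ip; have := wS l ip.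
by have := compact_z_ge0 l.+1 ip; lra.
Qed.

Lemma pivot_ltq i l : (i < p)%N -> pivot i l -> (l < q)%N.
Proof.
move=> ip; rewrite ltnNge; apply: contraL => ql.
by rewrite /pivot !compact_w_out ?ql ?orbT ?(ltnW ip) // !zq ?(leqW ql) // !subr0 ltxx.
Qed.

Lemma round_z_rec i j : (i < p)%N -> round_z i j = pivot i j || round_z i j.+1.
Proof.
move=> ip; apply/existsP/orP => [[l /andP[]]|[pij|/existsP[l /andP[jl pl]]]].
- rewrite leq_eqVlt => /predU1P[<-|jl pl]; first by left.
  by right; apply/existsP; exists l; rewrite jl.
- by exists (Ordinal (pivot_ltq ip pij)); rewrite leqnn.
- by exists l; rewrite ltnW.
Qed.

Lemma round_z_out i j : (q <= j)%N -> round_z i j = false.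
Proof.
by move=> qj; apply/existsP => -[l]; rewrite leqNgt (leq_trans (ltn_ord l)).
Qed.

(** Induction from right to left, with all columns from [q] on as base case; it fits the recursion
    [round_z_rec]. *)
Lemma column_ind (P : nat -> Prop) :
  (forall j, (q <= j)%N -> P j) -> (forall j, P j.+1 -> P j) -> forall j, P j.
Proof.
move=> Pq PS j; have [n] := ubnP (q - j)%N; elim: n j => // n IHn j lejn.
have [/Pq//|jq] := leqP q j; apply/PS/IHn; lia.
Qed.

Lemma round_z_w i j : (i < p)%N -> round_z i j -> round_w i.+1 j.
Proof.
move=> ip; elim/column_ind: j => [j qj|j IHj]; first by rewrite round_z_out.
rewrite round_z_rec // => /orP[/(pivot_w_gt0 ip)//|/IHj wj].
exact: lt_le_trans (compact_w_anti _ _).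
Qed.

(** If [round_z i j] is false, no column from [j] on is a pivot, and then [z i j < w i.+1 j] as soon
    as [w i.+1 j > 0]. Indeed the covering inequality is tight and [w i j > 0], so it suffices that
    [z i j.+1 < w i j]. This follows from [z i j.+1 <= w i.+1 j.+1 <= w i j], where the first step
    is strict by induction if [w i.+1 j.+1 > 0], and the second is strict otherwise. *)
Lemma round_w_z_tight i j : (i < p)%N -> z i j = w i.+1 j ->
  round_z i j = round_w i.+1 j.
Proof.
move=> ip tij; apply/idP/idP; first exact: round_z_w.
apply: contraTT => nz; rewrite /round_w.
suff : 0 < w i.+1 j -> z i j < w i.+1 j.
  by rewrite tij ltxx => w_le0; apply/negP => /w_le0.
elim/column_ind: j nz {tij} => [j qj _|j IHj]; first by rewrite zq.
rewrite round_z_rec // negb_or /pivot negb_or negb_and => /andP[/andP[pj tj] nz] wj.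
rewrite wj /= in pj; have := compact_w_ge0 j (ltnW ip).
rewrite le_eqVlt eq_sym (negPf pj) /= => wij.
have [wj1|wj1] := ltP 0 (w i.+1 j.+1).
  by have := IHj nz wj1; have := wSS j ip; lra.
have := zlew j.+1 ip; lra.
Qed.

(** The left side is 1 only if [w i j = 0 < w i.+1 j]. Then [j] is a pivot, and no later pivot
    exists because [w i.+1 j.+1 <= w i j = 0]. *)
Lemma round_cover i j : (i < p)%N ->
  (round_w i.+1 j)%:R - (round_w i j)%:R <=
    (round_z i j)%:R - (round_z i j.+1)%:R :> R.
Proof.
move=> ip; rewrite (round_z_rec _ ip).
have [wij|nwij] := boolP (round_w i j).
  rewrite /round_w (lt_le_trans wij (wS j ip)).
  by case: pivot; case: round_z; rewrite /=; lra.
have wij : w i j = 0.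
  by apply/eqP; rewrite eq_le leNgt nwij compact_w_ge0 // ltnW.
have -> : round_z i j.+1 = false.
  apply/negbTE/negP => /(round_z_w ip); rewrite /round_w => wij1.
  by have := lt_le_trans wij1 (wSS _ ip); rewrite wij ltxx.
rewrite /pivot wij eqxx andbT -/(round_w i.+1 j).
by case: (round_w i.+1 j) => /=; case: ltP => //=; lra.
Qed.

(** Without slack, [j] can be a pivot only because a 1 is forced there, and then the left side is 1
    too. *)
Lemma round_cover_tight i j : (i < p)%N ->
  w i.+1 j - w i j = z i j - z i j.+1 ->
  (round_w i.+1 j)%:R - (round_w i j)%:R =
    (round_z i j)%:R - (round_z i j.+1)%:R :> R.
Proof.
move=> ip tij; apply/eqP; rewrite eq_le round_cover //=.
rewrite (round_z_rec _ ip) /pivot tij ltxx orbF -/(round_w i.+1 j).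
have [wij|wij] := eqVneq (w i j) 0.
  by rewrite andbT /round_w wij ltxx; case: (0 < _); case: round_z; rewrite /=; lra.
have {}wij : 0 < w i j by rewrite lt_def wij compact_w_ge0 // ltnW.
rewrite /round_w wij (lt_le_trans wij (wS j ip)).
by case: round_z; rewrite /=; lra.
Qed.

Lemma compact_round :
  compact 1 (fun i j => (round_z i j)%:R) (fun i j => (round_w i j)%:R).
Proof.
split.
- by split=> [j|i j _ /round_z_out->//]; rewrite /round_w w0 ltxx.
- have mono (a b : R) : a <= b -> (0 < a)%R%:R <= (0 < b)%R%:R :> R.
    by move=> ab; rewrite ler_nat; case: ltP => // a0; rewrite (lt_le_trans a0).
  by move=> i j ip; split; apply: mono; [apply: wS|apply: wSS].
- by rewrite lern1 leq_b1.
- exact: round_cover.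
- move=> i j ip; rewrite ler_nat.
  by have := round_z_w (j := j) ip; case: round_z => // ->.
Qed.

End Theory.
End CompactSystem.

(** * Binary points of the system and orbitope matrices *)

Section Matrices.
Variables (R : realType) (p q : nat).
Implicit Types (A : 'M[R]_(p, q)) (z w : nat -> nat -> R).

(** The flag [part] selects the generators of the partitioning or of the packing orbitope, so that
    one argument treats both. *)
Definition orbitope_mx (part : bool) A : Prop :=
  [/\ zero_one A, lex_columns A
    & forall i, if part then #|[set j | A i j == 1%R]%SET| = 1%N
                else (#|[set j | A i j == 1%R]%SET| <= 1)%N].

Lemma card_row_eq1 A i : zero_one A ->
  #|[set j | A i j == 1%R]%SET|%:R = \sum_j A i j.
Proof.
move=> A01; rewrite -sum1_card big_mkcond natr_sum; apply: eq_bigr => j _.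
by rewrite inE; case: (A01 i j) => ->; rewrite ?eqxx // eq_sym oner_eq0.
Qed.

Definition diff_mx z : 'M[R]_(p, q) := \matrix_(i, j) (z i j - z i j.+1).

Lemma sum_diff_mx t z w i : compact p q t z w ->
  \sum_j diff_mx z i j = z i 0%N.
Proof.
move=> zwP; under eq_bigr do rewrite mxE.
rewrite -(big_mkord xpredT (fun j => z i j - z i j.+1)).
under eq_bigr do rewrite -opprB.
rewrite sumrN telescope_sumr // opprB; case: zwP => -[_ zq] _ _ _ _.
by rewrite (zq i q) ?subr0.
Qed.

Lemma eq_compact t z w z' w' :
  (forall i j, (i < p)%N -> z i j = z' i j) ->
  (forall i j, (i <= p)%N -> w i j = w' i j) ->
  compact p q t z w -> compact p q t z' w'.
Proof.
move=> zz ww [[w0 zq] wS wp cover zw]; split.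
- split=> [j|i j ip qj]; first by rewrite -ww.
  by rewrite -zz // zq.
- by move=> i j ip; rewrite -!ww ?(ltnW ip) //; exact: wS.
- by rewrite -ww.
- by move=> i j ip; rewrite -!ww ?(ltnW ip) // -!zz //; exact: cover.
- by move=> i j ip; rewrite -ww // -zz //; exact: zw.
Qed.

(* In the face [w 1 0 = 1] the variables [z i 0] do not have to be 1; raising
   them to [w i.+1 0] puts the missing 1-entries into the first column. *)
Definition saturate (part : bool) z w i j : R :=
  if part && (j == 0%N) then w i.+1 j else z i j.

(** Among the covering inequalities only those of column 0 change. They become [z i 1 <= w i 0],
    which holds because [z i 1 <= w i.+1 1 <= w i 0]. *)
Lemma compact_saturate part t z w : (0 < q)%N ->
  compact p q t z w -> compact p q t (saturate part z w) w.
Proof.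
move=> q0 zwP; have [[w0 zq] wS wp cover zlew] := zwP; rewrite /saturate.
split=> //.
- split=> // i j ip qj; rewrite gtn_eqF ?(leq_trans q0) // andbF; exact: zq.
- move=> i [|j] ip; rewrite ?andbF ?andbT //=; last exact: cover.
  case: part => //; last exact: cover.
  have := zlew i 1%N ip; have [_] := wS i 0%N ip; lra.
- by move=> i j ip; case: ifP => // _; exact: zlew.
Qed.

Lemma orbitope_mx_of_compact (part : bool) z w : compact p q 1 z w ->
  (forall i j, (i < p)%N -> z i j = 0 \/ z i j = 1) ->
  (forall i j, (i <= p)%N -> w i j = 0 \/ w i j = 1) ->
  (part -> forall i, (i < p)%N -> z i 0%N = 1) ->
  orbitope_mx part (diff_mx z).
Proof.
move=> zwP z01 w01 z1; have [_ wS _ cover zlew] := zwP.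
have A01 : zero_one (diff_mx z).
  move=> i j; rewrite mxE; have := compact_z_antiS zwP j (ltn_ord i).
  by case: (z01 i j) => // ->; case: (z01 i j.+1) => // ->; [left|left|right|left]; lra.
split=> //.
- move=> j k jk; apply/lexi_tupleP.
  (* [m] is the row where column [j] of [w] first becomes nonzero, or [p] if there is none; in
     [lexi_tupleP] the witness [p] stands for equal columns. *)
  have [|m /orP mP minm] := @ex_minnP (fun m => (m == p) || (w m.+1 j != 0)).
    by exists p; rewrite eqxx.
  have mp : (m < p.+1)%N by rewrite ltnS minm // eqxx.
  exists (Ordinal mp) => i /= im; rewrite !tnth_mktuple !mxE.
  have zle l : (j <= l)%N -> z i l <= z i j.
    by apply: (compact_z_anti zwP).
  have zge0 l : 0 <= z i l by apply: (compact_z_ge0 zwP).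
  (* In row [m] the covering inequality forces [z m j = 1] and [z m j.+1 = 0], so column [j] has a 1
     and column [k] a 0. In the rows above, [z <= w] makes both entries 0. *)
  move: im; rewrite leq_eqVlt => /predU1P[im|im].
    rewrite (introT eqP im); apply/leifP => /=.
    have {}mP : w i.+1 j != 0.
      by case: mP; rewrite -im // => /eqP ip; move: (ltn_ord i); rewrite ip ltnn.
    have wij : w i j = 0.
      case def_i : (nat_of_ord i) => [|i']; first by case: zwP => -[].
      apply/eqP/negPn/negP => nw; have := minm i'; rewrite nw orbT -im def_i.
      by rewrite ltnn => /(_ isT).
    have wij1 : w i.+1 j = 1 by case: (w01 i.+1 j (ltn_ord i)) mP => // ->; rewrite eqxx.
    have := cover i j (ltn_ord i); rewrite wij wij1.
    have : z i k <= z i j.+1 by apply: (compact_z_anti zwP).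
    have := zge0 k.+1; have := zge0 j.+1; have := zle j.+1 (leqnSn j).
    have : z i j <= 1 by case: (z01 i j) => // ->; rewrite ?lexx ?ler01.
    lra.
  rewrite ltn_eqF //; apply/leifP => /=.
  have wij : w i.+1 j = 0.
    apply/eqP/negPn/negP => nw; have := minm i; rewrite nw orbT leqNgt im.
    by move=> /(_ isT).
  have z0 l : (j <= l)%N -> z i l = 0.
    move=> jl; apply/eqP; rewrite eq_le zge0 andbT -wij.
    by apply: le_trans (zle _ jl) (zlew _ _ _).
  by apply/eqP; rewrite !z0 // ?leqW // ltnW.
- move=> i; have cardE := card_row_eq1 i A01; rewrite (sum_diff_mx i zwP) in cardE.
  case: part z1 => [z1|_].
    by apply/eqP; rewrite -(eqr_nat R) cardE z1.
  by rewrite -(ler_nat R) cardE; case: (z01 i 0%N (ltn_ord i)) => ->; rewrite ?ler01.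
Qed.

(** * The binary point belonging to a packing matrix *)

Section OfMatrix.
Variable A : 'M[R]_(p, q).
Hypothesis Amx : orbitope_mx false A.

Let A01 : zero_one A. Proof. by case: Amx. Qed.

Let one i j : bool :=
  [exists i' : 'I_p, exists j' : 'I_q,
    [&& i' == i :> nat, j' == j :> nat & A i' j' == 1]].

Let oneE (i : 'I_p) (j : 'I_q) : A i j = (one i j)%:R.
Proof.
have -> : one i j = (A i j == 1).
  apply/existsP/eqP => [[i' /existsP[j' /and3P[/eqP/val_inj-> /eqP/val_inj-> /eqP]]]//|Aij].
  by exists i; apply/existsP; exists j; rewrite !eqxx Aij eqxx.
by case: (A01 i j) => ->; rewrite ?eqxx // eq_sym oner_eq0.
Qed.

Let oneT (i : 'I_p) (j : 'I_q) : A i j = 1 -> one i j.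
Proof. by rewrite oneE; case: (one i j) => // /eqP; rewrite eq_sym oner_eq0. Qed.

Let oneP i j : one i j -> exists (i' : 'I_p) (j' : 'I_q),
  [/\ i = i', j = j' & A i' j' = 1].
Proof.
by case/existsP=> i' /existsP[j' /and3P[/eqP<- /eqP<- /eqP]]; exists i', j'.
Qed.

Let one_inj i j k : one i j -> one i k -> j = k.
Proof.
case/oneP=> i' [j' [-> -> Aij]] /oneP[i'' [k' [/val_inj<- -> Aik]]].
have [_ _ /(_ i')/card_le1_eqP] := Amx.
by move=> /(_ j' k') ->//; rewrite inE ?Aij ?Aik.
Qed.

(** Row [i] has its only 1 in column [k], so there column [k] exceeds column [j]. The lexicographic
    comparison must therefore be decided strictly above row [i], by a 1 in column [j]. *)
Let one_lex i j k : one i k -> (j < k)%N -> exists2 i', (i' < i)%N & one i' j.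
Proof.
case/oneP=> i0 [k0 [-> -> Aik]] jk.
pose j0 := Ordinal (ltn_trans jk (ltn_ord k0)).
have Aij : A i0 j0 = 0.
  case: (A01 i0 j0) => // Aij; have /= jk' := one_inj (oneT Aij) (oneT Aik).
  by have := jk; rewrite jk' ltnn.
have [_ /(_ j0 k0 jk)/lexi_tupleP[m lexm] _] := Amx.
have [mi|im] := ltnP m i0; last first.
  have := (lexm i0 im).1; rewrite !tnth_mktuple Aij Aik.
  by rewrite leNgt ltr01.
pose m0 := Ordinal (ltn_trans mi (ltn_ord i0)).
exists m0 => //; have := lexm m0 (leqnn _).
rewrite eqxx !tnth_mktuple => /leifP /= lt_kj.
apply: (@oneT m0 j0); case: (A01 m0 j0) lt_kj => // ->.
by case: (A01 m0 k0) => ->; rewrite ?ltxx // ltNge ler01.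
Qed.

Let one_out i j : (q <= j)%N -> one i j = false.
Proof.
move=> qj; apply/negbTE/negP => /oneP[i' [j' [_ jj' _]]].
by move: (ltn_ord j'); rewrite -jj' ltnNge qj.
Qed.

(** Row [i] is excluded here, in keeping with the zero row 0 of [w], whereas [zof] includes column
    [j]. *)
Let wof i j := has (one^~ j) (iota 0 i).
Let zof i j := has (one i) (iota j (q - j)).

Let wofS i j : wof i.+1 j = wof i j || one i j.
Proof. by rewrite /wof -addn1 iotaD has_cat /= orbF. Qed.

Let zof_rec i j : zof i j = one i j || zof i j.+1.
Proof.
have [qj|jq] := leqP q j; last by rewrite /zof -subnSK.
rewrite one_out // /zof.
by have := leqW qj; move: qj; rewrite -!subn_eq0 => /eqP-> /eqP->.
Qed.

Let wofP i j : reflect (exists2 i', (i' < i)%N & one i' j) (wof i j).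
Proof.
by apply: (iffP hasP) => -[i' ii' o]; exists i' => //; move: ii'; rewrite mem_iota.
Qed.

Let zofP i j : zof i j -> exists2 l, (j <= l)%N & one i l.
Proof. by case/hasP=> l; rewrite mem_iota => /andP[jl _]; exists l. Qed.

Let one_zof i j : one i j -> zof i j.+1 = false.
Proof.
move=> oij; apply/negbTE/negP => /zofP[l jl /(one_inj oij) jl'].
by move: jl; rewrite jl' ltnn.
Qed.

(** Both the diagonal inequality and [z <= w] come from [one_lex]: a 1 in some column implies one
    strictly higher in every earlier column. *)
Lemma compact_of_mx : exists z w : nat -> nat -> bool,
  compact p q (1 : R) (fun i j => (z i j)%:R) (fun i j => (w i j)%:R) /\
  A = diff_mx (fun i j => (z i j)%:R).
Proof.
exists zof, wof; split; last first.
  apply/matrixP => i j; rewrite mxE oneE zof_rec.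
  by have [/one_zof->|_] := boolP (one i j); rewrite ?subr0 ?subrr.
split.
- by split=> // i j _; rewrite -subn_eq0 /zof => /eqP->.
- move=> i j ip; rewrite !ler_nat; split; first by rewrite wofS; case: (wof i j).
  case: wofP => // -[i' ii'].
  move=> /one_lex/(_ (ltnSn j))[i2 i2i' o].
  by rewrite (introT (wofP _ _)) //; exists i2 => //; apply: leq_trans i2i' _.
- by rewrite lern1 leq_b1.
- move=> i j ip; rewrite wofS zof_rec.
  have [/one_zof->|_] := boolP (one i j);
    by case: (wof i j); case: (zof i j.+1); rewrite /=; lra.
- move=> i j ip; rewrite ler_nat; have := @zofP i j; case: (zof i j) => // /(_ isT)[l jl o].
  rewrite (introT (wofP _ _)) //; move: jl; rewrite leq_eqVlt => /predU1P[->|jl].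
    by exists i.
  by have [i' ii' oi'] := one_lex o jl; exists i' => //; apply: ltnW.
Qed.

End OfMatrix.
End Matrices.

(** * Polyhedral description, integrality and projection *)

Section Projection.
Variables (R : realType) (p q : nat).
Hypotheses (hq : (1 <= q)%N) (hpq : (q <= p)%N).

Local Notation zw_type := (trivec R p q * trivec R p q)%type.
Implicit Types (zw : zw_type) (part : bool).

Definition zent zw i j : R := ent zw.1 i.+1 j.+1.
Definition went zw i j : R := ent zw.2 i j.+1.

Lemma zent_out zw i j : (p <= i)%N || (q <= j)%N || (i < j)%N -> zent zw i j = 0.
Proof. by move=> out; apply: ent_out; rewrite /in_tri /=; lia. Qed.

Lemma went_out zw i j : (p < i)%N || (q <= j)%N || (i <= j)%N -> went zw i j = 0.
Proof. by move=> out; apply: ent_out; rewrite /in_tri /=; lia. Qed.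

Lemma zent_linear c zw zw' i j :
  zent (c *: zw + zw') i j = c * zent zw i j + zent zw' i j.
Proof. exact: ent_linear. Qed.

Lemma went_linear c zw zw' i j :
  went (c *: zw + zw') i j = c * went zw i j + went zw' i j.
Proof. exact: ent_linear. Qed.

(** Nothing is lost by storing only the triangle: outside it [w] vanishes by [compact_w_out], and
    [0 <= z i j <= w i.+1 j] takes [z] along. *)
Lemma compact_realize t z w : compact p q t z w -> exists zw,
  (forall i j, (i < p)%N -> zent zw i j = z i j) /\
  (forall i j, (i <= p)%N -> went zw i j = w i j).
Proof.
move=> zwP.
exists (of_ent p q (fun i j => z i.-1 j.-1), of_ent p q (fun i j => w i j.-1)).
split=> i j ip; rewrite /zent /went ent_of_ent /=; case: ifPn => // out.
  apply/esym/eqP; rewrite eq_le (compact_z_ge0 zwP) // andbT.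
  rewrite -(@compact_w_out _ _ _ _ _ _ zwP i.+1 j) //; first by case: zwP => _ _ _ _; apply.
  by move: out; rewrite /in_tri; lia.
by rewrite (compact_w_out zwP) //; move: out; rewrite /in_tri; lia.
Qed.

Definition Pset part : set zw_type :=
  if part then @Pcomp_face R p q else @Pcomp R p q.

(** All families share the index [(i, j)], so those that do not depend on it are repeated. The last
    one reads [w 1 0 >= 1] on the face and [0 <= 0] otherwise. *)
Definition cons_lhs part zw (k : 'I_p * 'I_q * 'I_6) : R^o :=
  let: (i, j, c) := k in let z := zent zw in let w := went zw in
  nth 0 [:: w i j - w i.+1 j; w i.+1 j.+1 - w i j; w p 0%N;
            w i.+1 j - w i j - z i j + z i j.+1; z i j - w i.+1 j;
            - (part%:R * w 1%N 0%N)] c.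

Definition cons_rhs part (k : 'I_p * 'I_q * 'I_6) : R :=
  nth 0 [:: 0; 0; 1; 0; 0; - part%:R] k.2.

Lemma cons_lhs_linear part k : linear (cons_lhs part ^~ k).
Proof.
move=> a u v; rewrite /cons_lhs; case: k => [[i j] [c ltc]] /=.
by do 6?[case: c ltc => [|c] ltc /=];
  rewrite ?zent_linear ?went_linear /GRing.scale //=; ring.
Qed.

Definition cons_form part k : {linear zw_type -> R^o} :=
  HB.pack (cons_lhs part ^~ k)
    (GRing.isLinear.Build R zw_type R^o *:%R (cons_lhs part ^~ k)
      (cons_lhs_linear part k)).

(** The factor [t] covers two cases at once: [t = 1] is the polyhedron itself, [t = 0] its recession
    cone. *)
Lemma cons_compact part t zw :
  (forall k, cons_form part k zw <= t * cons_rhs part k) <->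
  compact p q t (zent zw) (went zw) /\ (part -> t <= went zw 1%N 0%N).
Proof.
have p0 : (0 < p)%N := leq_trans hq hpq.
split=> [lek|[[_ wS wp cover zlew] w11] [[i j] [c ltc]]]; last first.
  rewrite /cons_form /cons_rhs /=.
  have [wij wSij] := wS i j (ltn_ord i).
  have zwij := zlew i j (ltn_ord i); have cij := cover i j (ltn_ord i).
  do 6?[case: c ltc => [|c] ltc //=]; rewrite ?mulr0 ?mulr1 ?subr_le0 //; first lra.
  by case: part w11 => [/(_ isT)|_] /=; lra.
have lekE i (ip : (i < p)%N) j (jq : (j < q)%N) c (ltc : (c < 6)%N) :=
  lek (Ordinal ip, Ordinal jq, Ordinal ltc).
rewrite /cons_form /cons_rhs /= in lekE.
split; last first.
  move=> parttrue; have := lekE 0%N p0 0%N hq 5%N isT.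
  by rewrite parttrue /=; lra.
have out i j : (i <= p)%N -> (q <= j)%N -> went zw i j = 0.
  by move=> ip qj; rewrite went_out // qj orbT.
have zout i j : (i <= p)%N -> (q <= j)%N -> zent zw i j = 0.
  by move=> ip qj; rewrite zent_out // qj orbT.
split.
- split=> [j|i j ip]; first by rewrite went_out // orbT.
  by apply: zout; rewrite ltnW.
- move=> i j ip; have [qj|jq] := leqP q j.
    by rewrite !out ?(ltnW ip) // leqW.
  have := lekE i ip j jq 0%N isT; have := lekE i ip j jq 1%N isT.
  by rewrite /=; lra.
- have := lekE 0%N p0 0%N hq 2%N isT; by rewrite /= mulr1.
- move=> i j ip; have [qj|jq] := leqP q j.
    by rewrite !out ?(ltnW ip) // !zout ?(ltnW ip) // leqW.
  by have := lekE i ip j jq 3%N isT; rewrite /=; lra.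
- move=> i j ip; have [qj|jq] := leqP q j.
    by rewrite out ?zout // ltnW.
  by have := lekE i ip j jq 4%N isT; rewrite /=; lra.
Qed.

(** [Pcomp] ranges over the triangle only; the additional inequalities of [compact] relate entries
    that all read as 0. *)
Lemma Pcomp_compact zw : Pcomp zw <-> compact p q 1 (zent zw) (went zw).
Proof.
split=> [[wS [wSS [wp [cover [zlew _]]]]]|zwP].
  split.
  - by split=> [j|i j ip qj]; [rewrite went_out|rewrite zent_out] => //; lia.
  - move=> i j ip; split.
      have [jq|qj] := ltnP j (minn i.+1 q); first by rewrite -subr_ge0 wS.
      by rewrite !went_out //; lia.
    have [jt|out] := boolP (in_tri p q i j.+1); first by rewrite -subr_ge0 wSS.
    by rewrite !went_out //; move: out; rewrite /in_tri; lia.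
  - exact: wp.
  - move=> i j ip; have [jt|out] := boolP (in_tri p q i.+1 j.+1).
      by have := cover _ _ jt; rewrite /zent /went /=; lra.
    by rewrite !went_out ?zent_out ?subr0 //; move: out; rewrite /in_tri; lia.
  - move=> i j ip; have [jt|out] := boolP (in_tri p q i.+1 j.+1).
      by rewrite -subr_le0 zlew.
    by rewrite went_out ?zent_out //; move: out; rewrite /in_tri; lia.
have [_ wS wp cover zlew] := zwP.
split; first by move=> i j ip _; rewrite subr_ge0; have [] := wS i j ip.
have in_tri0 i : in_tri p q i 0 = false by rewrite /in_tri andbF.
split.
  move=> i [|j]; rewrite ?in_tri0 // => _ ip.
  by rewrite subr_ge0; have [] := wS i j ip.
split=> //.
split.
  move=> [|i] [|j]; rewrite ?in_tri0 // => /and3P[ip _ _]; have := cover i j ip.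
  by rewrite /zent /went /=; lra.
split.
  move=> [|i] [|j]; rewrite ?in_tri0 // => /and3P[ip _ _].
  by rewrite subr_le0 zlew.
move=> i /andP[i0 ip]; case def_j: (minn i q) => [|j]; last exact: (compact_w_ge0 zwP).
by rewrite ent_out // in_tri0.
Qed.

Lemma Pset_compact part zw : Pset part zw <->
  compact p q 1 (zent zw) (went zw) /\ (part -> 1 <= went zw 1%N 0%N).
Proof.
rewrite /Pset; case: part; last first.
  by split=> [/Pcomp_compact|[/Pcomp_compact]].
split=> [[/Pcomp_compact zwP w11]|[zwP /(_ isT) w11]].
  by split=> // _; rewrite /went w11.
split; first exact/Pcomp_compact.
by apply/eqP; rewrite eq_le w11 (compact_w_le zwP) // (leq_trans hq).
Qed.

Lemma PsetE part :
  Pset part = [set zw | forall k, cons_form part k zw <= cons_rhs part k].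
Proof.
apply/seteqP; split=> zw /=.
  move/Pset_compact/cons_compact => lek k; have := lek k; by rewrite mul1r.
move=> lek; apply/Pset_compact/cons_compact => k; rewrite mul1r.
exact: lek.
Qed.

Definition binary zw : Prop := forall i j,
  (zent zw i j = 0 \/ zent zw i j = 1) /\ (went zw i j = 0 \/ went zw i j = 1).

Lemma Pset_eq_conv_hull part :
  Pset part = conv_hull [set zw | Pset part zw /\ binary zw].
Proof.
rewrite {1}PsetE; apply: polyhedron_eq_conv_hull.
(* At [t = 0] every entry in range is squeezed between 0 and 0. *)
- move=> d d0; have /cons_compact[dP _] k : cons_form part k d <= 0 * cons_rhs part k.
    by rewrite mul0r.
  have wd i j : (i <= p)%N -> went d i j = 0.
    move=> ip; apply/eqP; rewrite eq_le (compact_w_ge0 dP) // andbT.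
    exact: (compact_w_le dP).
  have zd i j : (i < p)%N -> zent d i j = 0.
    move=> ip; apply/eqP; rewrite eq_le (compact_z_ge0 dP) // andbT.
    exact: (compact_z_le dP).
  case: d {d0 dP} zd wd => dz dw zd wd; congr (_, _); apply: trivec_eqP => i j.
    rewrite [RHS]ent0.
    case: j => [|j]; first by rewrite ent_out // /in_tri ?andbF.
    case: i => [|i]; first by rewrite ent_out.
    have [ip|pi] := ltnP i p; first exact: (zd i j ip).
    by rewrite ent_out // /in_tri; lia.
  rewrite [RHS]ent0.
  case: j => [|j]; first by rewrite ent_out // /in_tri ?andbF.
  have [ip|pi] := leqP i p; first exact: (wd i j ip).
  by rewrite ent_out // /in_tri; lia.
- by move=> s [+ _]; rewrite PsetE.
- move=> y /= Py.
  have [yP w11] : compact p q 1 (zent y) (went y) /\ (part -> 1 <= went y 1%N 0%N).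
    by apply/cons_compact => k; rewrite mul1r; exact: Py.
  have sP := compact_round yP; have [s [zs ws]] := compact_realize sP.
  have p0 : (0 < p)%N := leq_trans hq hpq.
  have w11s : part -> went s 1%N 0%N = 1.
    by rewrite ws // /round_w => /w11/(lt_le_trans ltr01)->.
  exists s; first split.
  + apply/Pset_compact; split=> [|/w11s->//].
    by apply: eq_compact sP => // i j ip; [rewrite zs|rewrite ws].
  + move=> i j; split.
      have [ip|pi] := ltnP i p; last by rewrite zent_out ?pi //; left.
      by rewrite zs //; case: round_z; [right|left].
    have [ip|pi] := leqP i p; last by rewrite went_out ?pi //; left.
    by rewrite ws //; case: round_w; [right|left].
  (* Tightness family by family: equal entries of [w] have the same support indicator, [w p 0 = 1]
     is positive, the families with [z] are the two tightness lemmas, and the face constraint is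
     [w11s]. *)
  move=> [[i j] [c ltc]]; rewrite /cons_form /cons_rhs /=.
  have ip := ltn_ord i; have ip' := ltnW ip.
  do 6?[case: c ltc => [|c] ltc //=]; rewrite ?zs ?ws //.
  + by move=> /eqP; rewrite subr_eq0 /round_w => /eqP->; rewrite subrr.
  + by move=> /eqP; rewrite subr_eq0 /round_w => /eqP->; rewrite subrr.
  + by rewrite /round_w => ->; rewrite ltr01.
  + move=> tij; have := @round_cover_tight _ _ _ _ _ _ yP i j ip; lra.
  + by move=> /eqP; rewrite subr_eq0 => /eqP/(round_w_z_tight yP ip)->; rewrite subrr.
  + by case: part w11s {Py w11} => [w11s|_ _]; rewrite ?mul0r // -ws // w11s // mulr1.
Qed.

(** The index [j] counts from 1, so [zent zw i.-1 j] is the next column. It is never the first one,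
    hence saturation would not alter it. *)
Definition proj_fun part zw : trivec R p q :=
  of_ent p q (fun i j => saturate part (zent zw) (went zw) i.-1 j.-1 - zent zw i.-1 j).

Lemma proj_fun_linear part : linear (proj_fun part).
Proof.
move=> c u v; apply: trivec_eqP => i j; rewrite ent_linear !ent_of_ent.
case: ifP => _; last by rewrite mulr0 addr0.
by rewrite /saturate; case: ifP => _; rewrite !(zent_linear, went_linear); ring.
Qed.

Definition proj part : {linear zw_type -> trivec R p q} :=
  HB.pack (proj_fun part)
    (GRing.isLinear.Build R zw_type (trivec R p q) *:%R (proj_fun part)
      (proj_fun_linear part)).

Lemma drop_upper_linear : linear (@drop_upper R p q).
Proof. by move=> c A B; apply/ffunP => k; rewrite !ffunE !mxE. Qed.

HB.instance Definition _ :=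
  GRing.isLinear.Build R 'M[R]_(p, q) (trivec R p q) *:%R (@drop_upper R p q)
    drop_upper_linear.

Lemma saturateS part zw i j :
  saturate part (zent zw) (went zw) i j.+1 = zent zw i j.+1.
Proof. by rewrite /saturate andbF. Qed.

Lemma proj_diff_mx part zw : proj part zw =
  drop_upper (diff_mx p q (saturate part (zent zw) (went zw))).
Proof.
by apply/ffunP => k; rewrite !ffunE !mxE /= saturateS.
Qed.

(** On the face, saturated rows sum to [w i.+1 0 >= w 1 0 >= 1], which gives partitioning matrices.
    Conversely, the point built from a partitioning matrix already has [z i 0 = 1 = w i.+1 0], so
    saturation leaves it unchanged. *)
Lemma image_proj part :
  proj part @` [set zw | Pset part zw /\ binary zw] =
  @drop_upper R p q @` orbitope_mx part.
Proof.
apply/seteqP; split=> [_ [s [/Pset_compact[sP w11] s01] <-]|_ [A TA <-]].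
  exists (diff_mx p q (saturate part (zent s) (went s))); last by rewrite proj_diff_mx.
  apply: (orbitope_mx_of_compact (compact_saturate part hq sP)).
  - move=> i j _; rewrite /saturate.
    by case: ifP => _; have [] := s01 i j; have [] := s01 i.+1 j.
  - by move=> i j _; have [] := s01 i j.
  - move=> part1 i ip; rewrite /saturate part1 /=.
    apply/eqP; rewrite eq_le (compact_w_le sP) //= (le_trans (w11 part1)) //.
    by rewrite (compact_w_homo sP).
have Tf : orbitope_mx false A.
  by case: TA => A01 Alex; case: part => // card1; split=> // i; rewrite card1.
have [z [w [zwP AE]]] := compact_of_mx Tf.
have [s [zs ws]] := compact_realize zwP.
have z1 i : part -> (i < p)%N -> z i 0%N.
  move=> part1 ip; have [A01 _] := TA; rewrite part1 => /(_ (Ordinal ip)) card1.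
  have := card_row_eq1 (Ordinal ip) A01; rewrite card1 {1}AE (sum_diff_mx _ zwP).
  by case: (z i 0%N) => // /eqP; rewrite oner_eq0.
have w1 i : part -> (i < p)%N -> w i.+1 0%N.
  move=> part1 ip; case: zwP => _ _ _ _ /(_ i 0%N ip).
  by rewrite z1 // ler_nat; case: (w i.+1 0%N).
exists s; first split.
- apply/Pset_compact; split.
    by apply: eq_compact zwP => // i j ip; [rewrite zs|rewrite ws].
  move=> part1; rewrite ws ?w1 //; exact: leq_trans hq hpq.
- move=> i j; split.
    have [ip|pi] := ltnP i p; last by rewrite zent_out ?pi //; left.
    by rewrite zs //; case: (z i j); [right|left].
  have [ip|pi] := leqP i p; last by rewrite went_out ?pi //; left.
  by rewrite ws //; case: (w i j); [right|left].
rewrite proj_diff_mx AE; congr drop_upper; apply/matrixP => i j; rewrite !mxE saturateS.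
rewrite zs // /saturate; case: ifP => [/andP[part1 /eqP j0]|_]; last by rewrite zs.
by rewrite ws // j0 w1 // z1.
Qed.

Lemma bounded_Pset part : bounded_in (Pset part).
Proof.
pose e (l : tri p q + tri p q) : zw_type :=
  match l with inl k => ([ffun k' => (k == k')%:R], 0)
             | inr k => (0, [ffun k' => (k == k')%:R]) end.
apply: (bounded_in_span (e := e)) => zw /Pset_compact[zwP _].
exists (fun l => match l with inl k => zw.1 k | inr k => zw.2 k end).
  case=> k; rewrite -ent_val; have ip := ltn_ord (val k).1.
    have := compact_z_ge0 zwP (val k).2 ip; have := compact_z_le zwP (val k).2 ip.
    by move=> le1 ge0; rewrite ger0_norm.
  have := compact_w_ge0 zwP (val k).2 ip; have := compact_w_le zwP (val k).2 ip.
  by move=> le1 ge0; rewrite ger0_norm.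
have sumE (f : tri p q -> R) k : \sum_l f l * (l == k)%:R = f k.
  rewrite (bigD1 k) //= eqxx mulr1 big1 ?addr0 // => l /negPf->.
  by rewrite mulr0.
apply: injective_projections; rewrite raddf_sum big_sumType /=;
  apply/ffunP => k; rewrite ffunE !sum_ffunE.
  rewrite [X in _ + X]big1 ?addr0 => [|l _]; last by rewrite !ffunE scaler0.
  under eq_bigr do rewrite !ffunE; exact/esym/sumE.
rewrite big1 ?add0r => [|l _]; last by rewrite !ffunE scaler0.
under eq_bigr do rewrite !ffunE; exact/esym/sumE.
Qed.

Lemma extended_formulation_Pset part :
  extended_formulation (Pset part)
    (@drop_upper R p q @` conv_hull (orbitope_mx part)).
Proof.
split.
- split; first by exists _, (cons_form part), (cons_rhs part); exact: PsetE.
  exact: bounded_Pset.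
(* The dimension doubles, and it grows strictly because the pair (1, 1) lies in the index set. *)
- rewrite !dimvf.
  rewrite -[ltnRHS]/(dim (trivec R p q) + dim (trivec R p q))%N -addn1 leq_add2l.
  rewrite -[ltnRHS]/(#|{: tri p q}| * 1)%N muln1; apply/card_gt0P.
  by exists (exist _ (Ordinal (leq_trans hq hpq), Ordinal hq) (leq0n 0)).
- exists (proj part).
  (* Linear maps commute with convex hulls, so comparing the images of the generators suffices. *)
  by rewrite Pset_eq_conv_hull !image_conv_hull image_proj.
Qed.

End Projection.

Theorem theorem10 (R : realType) (p q : nat) (hq : (1 <= q)%N) (hpq : (q <= p)%N) :
  extended_formulation (@Pcomp R p q) (@packing_orbitope R p q) /\
  (forall zw, @Pcomp R p q zw -> (ent zw.2 1 1 <= 1)%R) /\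
  extended_formulation (@Pcomp_face R p q) (@partitioning_orbitope R p q).
Proof.
split; first exact: (extended_formulation_Pset R hq hpq false).
split; last exact: (extended_formulation_Pset R hq hpq true).
(* This valid inequality is what makes the equation [w_{1,1} = 1] cut out a face. *)
move=> zw /(Pcomp_compact hq hpq) zwP.
exact: (compact_w_le zwP 0%N (leq_trans hq hpq)).
Qed.
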